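(* For Matching in the Late Accept model, the competitive ratio is $2$; that is, there is a strictly $2$-competitive online algorithm in this model, and for every real $c<2$ no online algorithm in this model is $c$-competitive.
   Context: Online Matching (edge arrival). An input $\sigma$ is a finite simple undirected graph $G=(V,E)$ together with an ordering of its edges. Edges arrive one by one in this order; endpoints not seen before are revealed with the edge. All online algorithms are deterministic: each decision depends only on the part of the input revealed so far. After each arrival the algorithm maintains a set of currently accepted edges, which must be a matching (pairwise non-incident edges). $\mathrm{ALG}(\sigma)$ is the number of accepted edges at the end of the input, and $\mathrm{OPT}(\sigma)$ is the maximum cardinality of a matching in $G$; the objective is maximization. Late Accept model: in each step the algorithm may accept the newly arrived edge and/or any earlier edges that are not yet accepted; acceptance is irrevocable, i.e., an accepted edge can never be removed. An algorithm $\mathrm{ALG}$ is $c$-competitive if there is a constant $\alpha$ such that $\mathrm{OPT}(\sigma)\le c\,\mathrm{ALG}(\sigma)+\alpha$ for all inputs $\sigma$; it is strictly $c$-competitive if this holds with $\alpha=0$. By convention, ''the competitive ratio is $c$'' includes that the upper bound holds for the strict competitive ratio and the lower bound for the (non-strict) competitive ratio. *)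

(* Defs.v *)
From HB Require Import structures.
From mathcomp Require Import all_boot all_order all_algebra.
From mathcomp Require Import finmap reals.

Set Implicit Arguments.
Unset Strict Implicit.
Unset Printing Implicit Defensive.

Import Order.TTheory GRing.Theory Num.Theory.

Local Open Scope fset_scope.
Local Open Scope ring_scope.

(* Vertices are named by natural numbers, so that one online algorithm handles
   all finite graphs; an edge is the unoriented set of its two end points. *)
Definition edge := {fset nat}.

(* A finite simple undirected graph together with an ordering of its edges. *)
Record input := Input {
  vertices : {fset nat};
  edges : seq edge;
  edges_uniq : uniq edges;
  edgesP : all (fun e => (e `<=` vertices) && (#|` e| == 2)) edges
}.

Definition is_matching (M : {fset edge}) : bool :=
  [forall e : M, forall f : M,
     (val e != val f) ==> [disjoint (val e) & (val f)]%fset].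

Definition OPT (s : input) : nat :=
  \max_(M <- fpowerset [fset e in edges s] | is_matching M) #|` M|.

(* [d p] is the set of edges accepted in the step where the last edge of [p]
   arrives, [p] being the sequence of all edges revealed so far; the edges
   accepted earlier are determined by [d] and [p], so [d] need not see them. *)
Fixpoint accepted (d : seq edge -> {fset edge}) (es : seq edge) (k : nat)
    : {fset edge} :=
  if k is k'.+1 then accepted d es k' `|` d (take k es) else fset0.

Record late_accept_alg := LateAcceptAlg {
  decision :> seq edge -> {fset edge};
  decision_late_accept : forall (s : input) (k : nat), (k < size (edges s))%N ->
    decision (take k.+1 (edges s)) `<=`
      [fset e in take k.+1 (edges s)] `\` accepted decision (edges s) k;
  accepted_matching : forall (s : input) (k : nat), (k <= size (edges s))%N ->
    is_matching (accepted decision (edges s) k)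
}.

Definition ALG (A : late_accept_alg) (s : input) : nat :=
  #|` accepted A (edges s) (size (edges s))|.

Definition competitive_with (R : realType) (c alpha : R) (A : late_accept_alg)
    : Prop :=
  forall s : input, (OPT s)%:R <= c * (ALG A s)%:R + alpha.

Definition competitive (R : realType) (c : R) (A : late_accept_alg) : Prop :=
  exists alpha : R, competitive_with c alpha A.

Definition strictly_competitive (R : realType) (c : R) (A : late_accept_alg)
    : Prop :=
  competitive_with c 0 A.

(* Main.v *)
Require Import Defs.
From HB Require Import structures.
From mathcomp Require Import all_boot all_order all_algebra.
From mathcomp Require Import finmap reals.
From mathcomp Require Import zify lra.

(* Upper bound: greedy produces a maximal matching, and choosing in every edge
   of another matching a vertex covered by greedy is injective.
   Lower bound: the adversary reveals n disjoint edges and, as soon as one of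
   them is accepted, attaches a pendant edge to each of its end points.  If a of
   the n edges are eventually accepted, no pendant edge is, so ALG = a, whereas
   OPT >= 2a + (n - a) >= max(2a, n). *)

Import Order.TTheory GRing.Theory Num.Theory.

Local Open Scope fset_scope.

(** * Matchings, the optimum and prefixes of inputs *)

Lemma is_matchingP (M : {fset edge}) :
  reflect {in M &, forall e f : edge, e != f -> fdisjoint e f} (is_matching M).
Proof.
apply: (iffP forallP) => [h e f eM fM ef|h e].
  by have /forallP /(_ [` fM]) /implyP := h [` eM]; apply.
by apply/forallP => f; apply/implyP; apply: h; apply: valP.
Qed.

Lemma OPT_ge (s : input) (M : {fset edge}) :
  M `<=` [fset e in edges s] -> is_matching M -> (#|` M| <= OPT s)%N.
Proof.
move=> sub mM; rewrite /OPT.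
pose card (N : {fset edge}) := #|` N|.
by apply: (@leq_bigmax_seq _ _ _ card); rewrite ?fpowersetE.
Qed.

Lemma OPT_le (s : input) (m : nat) :
  (forall M : {fset edge}, M `<=` [fset e in edges s] -> is_matching M ->
    (#|` M| <= m)%N) ->
  (OPT s <= m)%N.
Proof.
by move=> h; apply/bigmax_leqP_seq => M; rewrite fpowersetE => sub; apply: h.
Qed.

Lemma edge_card (s : input) (e : edge) : e \in edges s -> #|` e| = 2.
Proof. by move=> es; have /allP /(_ _ es) /andP[_ /eqP] := edgesP s. Qed.

Lemma input_of_edges (es : seq edge) :
  uniq es -> all (fun e : edge => #|` e| == 2) es ->
  exists s : input, edges s = es.
Proof.
move=> ues /allP h.
have P : all (fun e : edge => (e `<=` \bigcup_(f <- es) f) && (#|` e| == 2)) es.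
  by apply/allP => e ees; rewrite h // andbT (bigfcup_sup _ ees).
by exists (Input ues P).
Qed.

Lemma acceptedS d es k :
  accepted d es k.+1 = accepted d es k `|` d (take k.+1 es).
Proof. by []. Qed.

Lemma accepted_mono d es k l : (k <= l)%N -> accepted d es k `<=` accepted d es l.
Proof.
elim: l => [|l IH]; first by rewrite leqn0 => /eqP->.
rewrite leq_eqVlt => /orP[/eqP->//|/IH h] /=.
exact: fsubset_trans h (fsubsetUl _ _).
Qed.

(** The first [k] decisions see only edges of [es1]. This is the online property that lets the
    adversary extend an input without disturbing what was accepted on it. *)
Lemma accepted_cat d es1 es2 k :
  (k <= size es1)%N -> accepted d (es1 ++ es2) k = accepted d es1 k.
Proof.
elim: k => //= k IH h; rewrite IH; last exact: ltnW.
by rewrite takel_cat.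
Qed.

Lemma accepted_sub_edges (A : late_accept_alg) (s : input) k :
  (k <= size (edges s))%N -> accepted A (edges s) k `<=` [fset e in edges s].
Proof.
elim: k => [|k IH] kn; first exact: fsub0set.
rewrite acceptedS fsubUset (IH (ltnW kn)) andTb.
apply/fsubsetP => e eA.
have /fsubsetP /(_ e eA) := decision_late_accept A kn.
by rewrite in_fsetD => /andP[_]; rewrite !inE => /mem_take.
Qed.

(** * The greedy algorithm *)

Definition greedy_step (M : {fset edge}) (e : edge) : {fset edge} :=
  if all (fun f : edge => fdisjoint e f) (enum_fset M) then e |` M else M.

Definition greedy (es : seq edge) : {fset edge} := foldl greedy_step fset0 es.

Lemma greedy_rcons es e : greedy (rcons es e) = greedy_step (greedy es) e.
Proof. exact: foldl_rcons. Qed.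

Lemma greedy_step_sub M e : M `<=` greedy_step M e.
Proof. by rewrite /greedy_step; case: ifP => // _; apply: fsubsetUr. Qed.

Lemma greedy_sub_edges es : greedy es `<=` [fset e in es].
Proof.
elim/last_ind: es => [|es e IH]; first exact: fsub0set.
apply/fsubsetP => f; rewrite greedy_rcons /greedy_step.
have h : f \in greedy es -> f \in rcons es e.
  by move=> /(fsubsetP IH); rewrite inE mem_rcons inE => ->; rewrite orbT.
case: ifP => _; rewrite !inE => //.
by case/orP => [/eqP->|]; [rewrite mem_rcons mem_head | exact: h].
Qed.

Lemma greedy_matching es : is_matching (greedy es).
Proof.
elim/last_ind: es => [|es e /is_matchingP IH]; first by apply/is_matchingP.
rewrite greedy_rcons /greedy_step; case: ifP => [/allP h|_]; last exact/is_matchingP.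
apply/is_matchingP => f g; rewrite !in_fset1U.
case/orP => [/eqP->|fM] /orP[/eqP->|gM]; rewrite ?eqxx // => fg.
- exact: h.
- by rewrite fdisjoint_sym; apply: h.
- exact: IH.
Qed.

(** An edge rejected on arrival meets an edge already chosen, and chosen edges stay. A chosen edge
    serves as its own witness, which is where [e != fset0] enters. *)
Lemma greedy_maximal es (e : edge) :
  e \in es -> e != fset0 -> exists2 f, f \in greedy es & ~~ fdisjoint e f.
Proof.
elim/last_ind: es => // es f IH; rewrite mem_rcons inE greedy_rcons.
case/orP => [/eqP-> f0|ees e0]; last first.
  have [g gG eg] := IH ees e0.
  by exists g => //; apply: (fsubsetP (greedy_step_sub _ _)).
rewrite /greedy_step; case: ifP => [_|/negbT /allPn[g gM fg]]; last by exists g.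
by exists f; rewrite ?fset1U1 // /fdisjoint fsetIid.
Qed.

(** Here [belast e p'] is the prefix without its last edge, so the decision is the increment of
    [greedy] in the current step. *)
Definition greedy_decision (p : seq edge) : {fset edge} :=
  if p is e :: p' then greedy p `\` greedy (belast e p') else fset0.

Lemma greedy_decision_rcons p e :
  greedy_decision (rcons p e) = greedy (rcons p e) `\` greedy p.
Proof.
case: p => [|x p] //.
by rewrite rcons_cons /= belast_rcons.
Qed.

(** The increments telescope, because [greedy] only grows along prefixes. *)
Lemma accepted_greedy es k :
  (k <= size es)%N -> accepted greedy_decision es k = greedy (take k es).
Proof.
elim: k => [|k IH] kn; first by rewrite take0.
rewrite acceptedS (IH (ltnW kn)) (take_nth fset0 kn) greedy_decision_rcons.
rewrite fsetUDl fsetDv fsetD0; apply/fsetUidPr.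
by rewrite greedy_rcons greedy_step_sub.
Qed.

Lemma greedy_decision_late_accept (s : input) (k : nat) :
  (k < size (edges s))%N ->
  greedy_decision (take k.+1 (edges s)) `<=`
    [fset e in take k.+1 (edges s)] `\` accepted greedy_decision (edges s) k.
Proof.
move=> kn; rewrite (accepted_greedy _ _ (ltnW kn)) (take_nth fset0 kn).
by rewrite greedy_decision_rcons; apply: fsetSD; apply: greedy_sub_edges.
Qed.

Lemma greedy_accepted_matching (s : input) (k : nat) :
  (k <= size (edges s))%N ->
  is_matching (accepted greedy_decision (edges s) k).
Proof. by move=> kn; rewrite (accepted_greedy _ _ kn); apply: greedy_matching. Qed.

Definition greedy_alg : late_accept_alg :=
  LateAcceptAlg greedy_decision_late_accept greedy_accepted_matching.

(** * Upper bound by counting covered vertices *)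

Lemma card_bigfcup (r : seq edge) m :
  (forall e : edge, e \in r -> (#|` e| <= m)%N) ->
  (#|` \bigcup_(e <- r) e| <= m * size r)%N.
Proof.
elim: r => [|e r IH] h; first by rewrite big_nil cardfs0.
rewrite big_cons /= mulnS.
apply: leq_trans (_ : #|` e| + #|` \bigcup_(f <- r) f| <= _)%N.
  by rewrite cardfsU leq_subr.
by rewrite leq_add ?h ?mem_head // IH // => f fr; rewrite h // inE fr orbT.
Qed.

(** Choosing in each edge of [M] a vertex of [V] is injective, since distinct edges of a matching
    share no vertex. *)
Lemma card_matching_le_cover (M : {fset edge}) (V : {fset nat}) :
  is_matching M -> {in M, forall e : edge, ~~ fdisjoint e V} ->
  (#|` M| <= #|` V|)%N.
Proof.
move=> /is_matchingP mM meet.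
(* The default [0] is never reached on [M], whose edges all meet [V]. *)
pose h (e : edge) := head 0%N (enum_fset (e `&` V)).
have hP e : e \in M -> h e \in e `&` V.
  move=> /meet; rewrite /fdisjoint /h -cardfs_gt0.
  have : {subset enum_fset (e `&` V) <= e `&` V} by [].
  case: (enum_fset _) => [|x l] sub //=.
  by move=> _; apply: sub; rewrite mem_head.
have inj : {in M &, injective h}.
  move=> e f eM fM ef; apply/eqP/negPn/negP => /(mM _ _ eM fM) /fdisjointP /(_ (h e)).
  have := hP _ fM; rewrite -ef; have := hP _ eM.
  by rewrite !inE => /andP[-> _] /andP[-> _] /(_ isT).
rewrite -(card_in_imfset imfset_key inj).
apply: fsubset_leq_card; apply/fsubsetP => x /imfsetP[e /= /hP].
by rewrite inE => /andP[_ hV] ->.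
Qed.

(** By maximality the end points of the greedy edges, at most two per edge, form a vertex cover of
    the graph. *)
Lemma OPT_le_greedy (s : input) : (OPT s <= 2 * ALG greedy_alg s)%N.
Proof.
rewrite /ALG (accepted_greedy _ _ (leqnn _)) take_size.
apply: OPT_le => M sub mM.
set G := greedy _.
have cG (e : edge) : e \in G -> #|` e| = 2.
  by move=> /(fsubsetP (greedy_sub_edges _)); rewrite inE; apply: edge_card.
apply: leq_trans (card_matching_le_cover M (\bigcup_(f <- G) f) mM _) _; last first.
  by apply: card_bigfcup => e /cG->.
move=> e /(fsubsetP sub); rewrite inE => es.
have e0 : e != fset0 by rewrite -cardfs_gt0 (edge_card _ _ es).
have [f fG] := greedy_maximal _ _ es e0.
apply: contraNN => /fdisjointWr; apply.
exact: bigfcup_sup.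
Qed.

(** * Gadgets of the lower bound *)

(* The [i]-th gadget is the path 4i+2, 4i, 4i+1, 4i+3: [gadget_edge (i, 0)] is
   its middle edge, [gadget_edge (i, 1)] and [gadget_edge (i, 2)] are pendant. *)
Definition gadget_edge (c : nat * nat) : edge :=
  [fset (4 * c.1 + (c.2 == 2))%N; (4 * c.1 + c.2.+1)%N].

Lemma in_gadget_edge v c : (v \in gadget_edge c) =
  (v == 4 * c.1 + (c.2 == 2))%N || (v == 4 * c.1 + c.2.+1)%N.
Proof. by rewrite !inE. Qed.

Lemma gadget_edge_meet v c c' : (c.2 < 3)%N -> (c'.2 < 3)%N ->
  v \in gadget_edge c -> v \in gadget_edge c' ->
  c.1 = c'.1 /\ [\/ c.2 = c'.2, c.2 = 0%N | c'.2 = 0%N].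
Proof.
case: c c' => [i j] [i' j'] /=; rewrite !in_gadget_edge /=.
case: j => [|[|[|]]] //= _; case: j' => [|[|[|]]] //= _ h h'.
all: split; [lia|].
all: try by constructor 1.
all: try by constructor 2.
all: try by constructor 3.
all: lia.
Qed.

Lemma gadget_edge_inj :
  {in [pred c : nat * nat | (c.2 < 3)%N] &, injective gadget_edge}.
Proof.
move=> [i j] [i' j']; rewrite !inE /= => hj hj' E.
(* Membership of both end points of the first edge in the second one gives linear conditions that
   force equal codes. *)
have := in_gadget_edge (4 * i + (j == 2))%N (i', j').
have := in_gadget_edge (4 * i + j.+1)%N (i', j').
rewrite -E !in_gadget_edge /= !eqxx orbT /=.
case: j hj {E} => [|[|[|]]] //= _; case: j' hj' => [|[|[|]]] //= _ h h'.
all: try by congr pair; lia.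
all: lia.
Qed.

Lemma gadget_edge_card c : (c.2 < 3)%N -> #|` gadget_edge c| = 2.
Proof.
case: c => [i j] /= hj; rewrite cardfs2; congr (_.+1).
by case: j hj => [|[|[|]]] //= _; lia.
Qed.

Definition middles (r : seq nat) : seq (nat * nat) := [seq (i, 0%N) | i <- r].
Definition pendants (S : seq nat) : seq (nat * nat) :=
  [seq (i, j) | i <- S, j <- [:: 1%N; 2]].

Lemma mem_middles r c : (c \in middles r) = (c.1 \in r) && (c.2 == 0%N).
Proof.
case: c => i j; apply/mapP/andP => /= [[k kr [-> ->]] //|[ir /eqP->]].
by exists i.
Qed.

Lemma mem_pendants S c :
  (c \in pendants S) = (c.1 \in S) && (c.2 \in [:: 1%N; 2]).
Proof.
case: c => i j; apply/allpairsP/andP => /= [[[k l] [kS lS [-> ->]]] //|[iS jS]].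
by exists (i, j).
Qed.

Lemma uniq_middles_pendants r S :
  uniq r -> uniq S -> uniq (middles r ++ pendants S).
Proof.
move=> ur uS; rewrite cat_uniq map_inj_uniq ?ur /=; last by move=> x y [].
apply/andP; split; last by apply: allpairs_uniq => // -[a b] [a' b'] _ _.
apply/hasPn => c; rewrite mem_pendants /= mem_middles => /andP[_].
by rewrite !inE => /orP[] /eqP->; rewrite andbF.
Qed.

Lemma gadget_codes_lt r S :
  {in middles r ++ pendants S, forall c, (c.2 < 3)%N}.
Proof.
move=> c; rewrite mem_cat mem_middles mem_pendants !inE.
by case/orP => /andP[_]; [move/eqP->|case/orP => /eqP->].
Qed.

(** All middle edges arrive first and the pendant pairs follow in the order of [S], so appending an
    index to [S] extends the input at its end. *)
Definition gadget_edges (r S : seq nat) : seq edge :=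
  map gadget_edge (middles r ++ pendants S).

Lemma uniq_gadget_edges r S : uniq r -> uniq S -> uniq (gadget_edges r S).
Proof.
move=> ur uS; rewrite map_inj_in_uniq ?uniq_middles_pendants //.
by move=> c c' /gadget_codes_lt h /gadget_codes_lt h'; apply: gadget_edge_inj.
Qed.

Lemma gadget_input r S : uniq r -> uniq S ->
  exists s : input, edges s = gadget_edges r S.
Proof.
move=> ur uS; apply: input_of_edges; first exact: uniq_gadget_edges.
by apply/allP => e /mapP[c /gadget_codes_lt h ->]; rewrite gadget_edge_card.
Qed.

(** * The adversary against an arbitrary algorithm *)

Definition gadget_accepted (A : late_accept_alg) (r S : seq nat) : {fset edge} :=
  accepted A (gadget_edges r S) (size (gadget_edges r S)).

Lemma gadget_accepted_rcons A r S i :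
  gadget_accepted A r S `<=` gadget_accepted A r (rcons S i).
Proof.
rewrite /gadget_accepted.
have -> : gadget_edges r (rcons S i) =
    gadget_edges r S ++ map gadget_edge (pendants [:: i]).
  by rewrite /gadget_edges /pendants -cats1 allpairs_cat catA [in LHS]map_cat.
rewrite -(@accepted_cat A (gadget_edges r S) (map gadget_edge (pendants [:: i]))) //.
by apply: accepted_mono; rewrite size_cat leq_addr.
Qed.

(** While some middle edge outside [S] is accepted, its index is appended to [S]. Irrevocability
    keeps the earlier middle edges accepted, and [S] cannot outgrow [r], so the process ends with
    [S] indexing exactly the accepted middle edges. *)
Lemma adversary_stops (A : late_accept_alg) r : uniq r ->
  exists S : seq nat, [/\ uniq S, {subset S <= r} &
    {in r, forall i, (gadget_edge (i, 0%N) \in gadget_accepted A r S) = (i \in S)}].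
Proof.
move=> ur.
suff H m S : (size r - size S <= m)%N -> uniq S -> {subset S <= r} ->
    {in S, forall i, gadget_edge (i, 0%N) \in gadget_accepted A r S} ->
    exists S : seq nat, [/\ uniq S, {subset S <= r} &
    {in r, forall i, (gadget_edge (i, 0%N) \in gadget_accepted A r S) = (i \in S)}].
  by apply: (H (size r) [::]); rewrite ?subn0.
elim: m S => [|m IH] S hm uS sub acc.
all: have [/hasP[i ir /andP[iS iacc]]|/hasPn none] := boolP (has (fun i =>
  (i \notin S) && (gadget_edge (i, 0%N) \in gadget_accepted A r S)) r).
1,3: have uiS : uniq (i :: S) by rewrite /= iS.
(* The strict inequality contradicts the bound when [m] is 0 and makes [size r - size S] drop
   otherwise. *)
1,2: have lt : (size S < size r)%N by
  apply: (uniq_leq_size uiS) => j; rewrite inE => /orP[/eqP->//|/sub].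
- lia.
- apply: (IH (rcons S i)); rewrite ?size_rcons ?rcons_uniq ?iS //; first lia.
  + by move=> j; rewrite mem_rcons inE => /orP[/eqP->//|/sub].
  + move=> j; rewrite mem_rcons inE => jS.
    apply: (fsubsetP (gadget_accepted_rcons A r S i)).
    by case/orP: jS => [/eqP->//|/acc].
all: exists S; split=> // i ir; apply/idP/idP => [iacc|/acc//].
all: by have := none _ ir; rewrite iacc andbT negbK.
Qed.

(** Only middle edges indexed by [S] can be accepted: pendant edges occur only in gadgets whose
    middle edge is accepted, and they meet it. *)
Lemma gadget_accepted_card A r S : uniq r -> uniq S -> {subset S <= r} ->
  {in r, forall i, (gadget_edge (i, 0%N) \in gadget_accepted A r S) = (i \in S)} ->
  (#|` gadget_accepted A r S| <= size S)%N.
Proof.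
move=> ur uS sub acc; have [s es] := gadget_input r S ur uS.
have mA : is_matching (gadget_accepted A r S).
  by rewrite /gadget_accepted -es accepted_matching.
apply: leq_trans (_ : size [seq gadget_edge (i, 0%N) | i <- S] <= _)%N; last first.
  by rewrite size_map.
apply: uniq_leq_size; first exact: fset_uniq.
move=> e eA.
have : e \in gadget_edges r S.
  rewrite -es; have := @accepted_sub_edges A s (size (edges s)) (leqnn _).
  by rewrite es => /fsubsetP /(_ _ eA); rewrite inE.
case/mapP => -[i j] cin E; move: cin.
rewrite mem_cat mem_middles mem_pendants /= => /orP[/andP[ir /eqP j0]|/andP[iS j12]].
  by subst j; apply/mapP; exists i => //; rewrite -acc // -E.
have iA : gadget_edge (i, 0%N) \in gadget_accepted A r S by rewrite acc // sub.
have ne : e != gadget_edge (i, 0%N).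
  apply/eqP; rewrite E => /gadget_edge_inj; rewrite !inE /=.
  by move: j12; rewrite !inE => /orP[] /eqP-> /(_ isT isT) [].
have /is_matchingP /(_ _ _ eA iA ne) /fdisjointP := mA.
(* This is the end point that pendant edge [j] shares with the middle edge. *)
move=> /(_ (4 * i + (j == 2))%N); rewrite E !in_gadget_edge /= eqxx /=.
by move: j12; rewrite !inE => /orP[] /eqP-> /(_ isT); lia.
Qed.

Lemma gadget_OPT (s : input) r S : uniq r -> uniq S -> {subset S <= r} ->
  edges s = gadget_edges r S -> (size r + size S <= OPT s)%N.
Proof.
move=> ur uS sub es.
(* The matching takes both pendant edges in gadgets of [S] and the middle edge in all others, hence
   [gadget_edges r' S]. *)
pose r' := [seq i <- r | i \notin S].
have ur' : uniq r' by rewrite filter_uniq.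
have sz : size (gadget_edges r' S) = (size r + size S)%N.
  rewrite size_map size_cat size_map size_allpairs /= muln2 -addnn addnA.
  congr addn; rewrite -[in RHS](count_predC [in S] r) addnC size_filter; congr addn.
  rewrite -size_filter; apply/perm_size/uniq_perm; rewrite ?filter_uniq // => i.
  by rewrite mem_filter; case: (boolP (i \in S)) => //= /sub->.
rewrite -sz -(undup_id (uniq_gadget_edges r' S ur' uS)) -card_fseq.
apply: OPT_ge.
  apply/fsubsetP => e; rewrite !inE es => /mapP[c cin ->]; apply: map_f.
  move: cin; rewrite !mem_cat !mem_middles mem_filter.
  by case/orP => [/andP[/andP[_ ->] ->]|->]; rewrite ?orbT.
apply/is_matchingP => e f; rewrite !inE => /mapP[c cin ->] /mapP[c' c'in ->] ne.
apply/fdisjointP => v vc; apply/negP => vc'.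
have [E1 E2] := gadget_edge_meet v c c' (gadget_codes_lt _ _ _ cin)
  (gadget_codes_lt _ _ _ c'in) vc vc'.
case/eqP: ne; congr gadget_edge.
move: cin c'in; rewrite !mem_cat !mem_middles !mem_pendants !mem_filter.
case: c c' E1 E2 {vc vc'} => [i j] [i' j'] /= <- E2.
rewrite !inE => h h'; congr pair.
(* Two meeting edges lie in one gadget: outside [S] both are its middle edge, inside [S] both are
   pendant and so equal. *)
case: (i \in S) h h' => /= h h'; last by lia.
by case: E2; lia.
Qed.

(** * The competitive ratio *)

Local Open Scope ring_scope.

Theorem theorem6 (R : realType) :
  (exists A : late_accept_alg, strictly_competitive (2 : R) A) /\
  (forall c : R, c < 2 -> forall A : late_accept_alg, ~ competitive c A).
Proof.
split.
  exists greedy_alg => s.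
  by rewrite addr0 -natrM ler_nat OPT_le_greedy.
move=> c c2 A [alpha comp].
(* With [n] gadgets the optimum will exceed [c] times the value of [A] by at least the right-hand
   side, so this [n] defeats [alpha]; the minimum is positive because [c < 2]. *)
have [n nbig] : exists n : nat, `|alpha| < n%:R * Num.min 1 (2 - c).
  have m0 : 0 < Num.min 1 (2 - c) by rewrite lt_min ltr01 subr_gt0.
  exists (Num.bound (`|alpha| / Num.min 1 (2 - c))).
  rewrite -ltr_pdivrMr //.
  by apply: archi_boundP; rewrite divr_ge0 // ltW.
have ur := iota_uniq 0 n.
have [S [uS sub acc]] := adversary_stops A _ ur.
have [s es] := gadget_input _ S ur uS.
have algS : (ALG A s <= size S)%N.
  by rewrite /ALG es; apply: gadget_accepted_card.
have optS := gadget_OPT s _ S ur uS sub es.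
have Sn := uniq_leq_size uS sub.
rewrite size_iota in optS Sn.
have {}optS : n%:R + (ALG A s)%:R <= (OPT s)%:R :> R.
  by rewrite -natrD ler_nat (leq_trans _ optS) // leq_add2l.
have {Sn}algn : (ALG A s)%:R <= n%:R :> R by rewrite ler_nat (leq_trans algS).
have a0 : 0 <= (ALG A s)%:R :> R by [].
have al := ler_norm alpha.
have aa : 0 <= `|alpha| by [].
have cs := comp s.
(* [n + a <= c a + alpha] with [0 <= a <= n]: the gap [n - (c - 1) a] is at least
   [n] if [c <= 1] and at least [(2 - c) n] otherwise. *)
have n1 : n%:R * Num.min 1 (2 - c) <= n%:R :> R.
  by rewrite ler_piMr // ge_min lexx.
have n2 : n%:R * Num.min 1 (2 - c) <= n%:R * (2 - c) :> R.
  by rewrite ler_wpM2l // ge_min lexx orbT.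
have [c1|c1] := leP c 1; nra.
Qed.
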